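(* Let $r\ge 2$ and $n\ge 1$ be integers and let $\mathcal J:\{1,\dots,r\}\to\mathbb R$ be a function with $\sigma_{\mathcal J}^2>0$. Let $\boldsymbol\pi_1,\dots,\boldsymbol\pi_n$ be i.i.d. uniformly distributed random permutations of $\{1,\dots,r\}$, let $\boldsymbol\theta=(\theta_1,\dots,\theta_n)$ be uniformly distributed on the unit sphere $\mathcal S^{n-1}\subset\mathbb R^n$ and independent of $\boldsymbol\pi_1,\dots,\boldsymbol\pi_n$, and let $$\mathcal T_{\mathcal J}=\frac1{\sigma_{\mathcal J}^2}\left\|\sum_{i=1}^n\theta_i\left(\boldsymbol V_i^{\mathcal J}-\overline{\mathcal J}\,\boldsymbol 1\right)\right\|^2 .$$ Assume that $|\mathcal J(k)-\overline{\mathcal J}|\le B$ for all $k\in\{1,\dots,r\}$, where $B$ is a constant (possibly depending on $r$). Then, for any $\delta\in(0,1)$, with probability at least $1-\delta$ over $\boldsymbol\theta$, it holds that $$\sup_{t\in\mathbb R}\left|\mathbb P\left(\mathcal T_{\mathcal J}>t\,\big|\,\boldsymbol\theta\right)-\mathbb P(Z>t)\right|\le\frac{C_{r-1}\,r^2B^2\log^2(1/\delta)}{\sigma_{\mathcal J}^2\,n},$$ where $Z\sim\chi^2(r-1)$.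
   Context: Notation: $\overline{\mathcal J}=\frac1r\sum_{k=1}^r\mathcal J(k)$, $\sigma_{\mathcal J}^2=\frac1{r-1}\sum_{k=1}^r(\mathcal J(k)-\overline{\mathcal J})^2$, $\boldsymbol\pi_i=(\pi_{i1},\dots,\pi_{ir})$, $\boldsymbol V_i^{\mathcal J}=(\mathcal J(\pi_{i1}),\dots,\mathcal J(\pi_{ir}))^\top\in\mathbb R^r$, $\boldsymbol 1=(1,\dots,1)^\top\in\mathbb R^r$, $\|\cdot\|$ is the Euclidean norm. The constant $C_d$: for an integer $d\ge1$, $C_d$ denotes the constant, depending only on $d$, from the following theorem of Ayvazyan and Ulyanov. Let $\boldsymbol\xi_1,\dots,\boldsymbol\xi_n$ be i.i.d. random vectors in $\mathbb R^d$ with $\mathbb E\boldsymbol\xi_1=\boldsymbol 0$, $\mathbb E\boldsymbol\xi_1\boldsymbol\xi_1^\top=I_d$, $\mathbb E\|\boldsymbol\xi_1\|^4<\infty$; let $\mathfrak B$ be the family of convex Borel sets in $\mathbb R^d$ and let $\boldsymbol\eta\sim\mathcal N(\boldsymbol 0,I_d)$. Then for any $\delta\in(0,1)$, with probability at least $1-\delta$ over $\boldsymbol\theta$ uniformly distributed on $\mathcal S^{n-1}$ (independent of the $\boldsymbol\xi_i$), $$\sup_{B\in\mathfrak B}\left|\mathbb P\left(\sum_{i=1}^n\theta_i\boldsymbol\xi_i\in B\,\Big|\,\boldsymbol\theta\right)-\mathbb P(\boldsymbol\eta\in B)\right|\le\frac{C_d\,\mathbb E\|\boldsymbol\xi_1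\|^4\log^2(1/\delta)}{n}.$$
   Formalization: As quoted, no finite C_d serves all δ in (0,1): the bound tends to 0 as δ→1 (fails for n=1). The formal version fixes any set D of levels in (0,1), takes C_d valid in the quoted theorem for all δ in D, and concludes for every δ in D. *)

(* Defs.v *)
From HB Require Import structures.
From mathcomp Require Import all_boot all_order all_algebra all_fingroup.
From mathcomp Require Import all_classical all_reals all_analysis.

Set Implicit Arguments.
Unset Strict Implicit.
Unset Printing Implicit Defensive.

Import Order.TTheory GRing.Theory Num.Theory.

Local Open Scope classical_set_scope.
Local Open Scope ring_scope.

(* A vector of R^d is a [d.-tuple R]; the library's sigma-algebra on tuples,
   generated by the coordinates, is the Borel sigma-algebra of R^d. *)
Section vectors.
Context {R : realType}.

Definition enorm d (x : d.-tuple R) : R := Num.sqrt (\sum_(k < d) tnth x k ^+ 2).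

Definition lincomb n d (a : n.-tuple R) (x : 'I_n -> d.-tuple R) : d.-tuple R :=
  [tuple \sum_(i < n) tnth a i * tnth (x i) k | k < d].

Definition mulmx_tuple d (M : 'M[R]_d) (x : d.-tuple R) : d.-tuple R :=
  [tuple \sum_(j < d) M i j * tnth x j | i < d].

Definition convex_tuple_set d (B : set (d.-tuple R)) : Prop :=
  forall (x y : d.-tuple R) (t : R), B x -> B y -> 0 <= t <= 1 ->
    B [tuple t * tnth x k + (1 - t) * tnth y k | k < d].

End vectors.

(* The permutation group carries the discrete sigma-algebra. *)
HB.instance Definition _ (I : finType) := isPointed.Build (perm_type I) 1%g.
HB.instance Definition _ (I : finType) :=
  @isMeasurable.Build default_measure_display (perm_type I)
    (@discrete_measurable (perm_type I)) (@discrete_measurable0 (perm_type I))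
    (@discrete_measurableC (perm_type I)) (@discrete_measurableU (perm_type I)).

Section probability_notions.
Context {R : realType} {dT : measure_display} {T : measurableType dT}.
Variable P : probability T R.

Definition mutually_independent {dU} {U : measurableType dU} n
    (X : 'I_n -> T -> U) : Prop :=
  forall (I : {set 'I_n}) (A : 'I_n -> set U), (forall i, measurable (A i)) ->
    P [set w | forall i, i \in I -> A i (X i w)]
    = (\prod_(i in I) P (X i @^-1` A i))%E.

Definition identically_distributed {dU} {U : measurableType dU} n
    (X : 'I_n -> T -> U) : Prop :=
  forall (i j : 'I_n) (A : set U), measurable A ->
    P (X i @^-1` A) = P (X j @^-1` A).

Definition iid {dU} {U : measurableType dU} n (X : 'I_n -> T -> U) : Prop :=
  mutually_independent X /\ identically_distributed X.

Definition independent {dU dV} {U : measurableType dU} {V : measurableType dV}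
    (X : T -> U) (Y : T -> V) : Prop :=
  forall (A : set U) (B : set V), measurable A -> measurable B ->
    P (X @^-1` A `&` Y @^-1` B) = (P (X @^-1` A) * P (Y @^-1` B))%E.

(* Independence of Y from the whole family X_0, ..., X_(n-1), seen as one
   random element of U^n. *)
Definition independent_of_family {dU dV} {U : measurableType dU}
    {V : measurableType dV} n (Y : T -> V) (X : 'I_n -> T -> U) : Prop :=
  independent Y (fun w => [tuple X i w | i < n]).

(* k is a regular conditional distribution of X given Y, so that
   P(X \in B | Y) (w) is k (Y w) B. *)
Definition conditional_distribution {dU dV} {U : measurableType dU}
    {V : measurableType dV} (X : T -> U) (Y : {RV P >-> V})
    (k : R.-pker V ~> U) : Prop :=
  forall (A : set V) (B : set U), measurable A -> measurable B ->
    P (Y @^-1` A `&` X @^-1` B) = (\int[distribution P Y]_(y in A) k y B)%E.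

Definition with_probability_ge (p : R) (E : set T) : Prop :=
  exists A : set T, [/\ measurable A, A `<=` E & (p%:E <= P A)%E].

(* The uniform distribution on the sphere is the rotation-invariant one; the
   full orthogonal group is used because SO(1) is trivial. *)
Definition uniform_on_sphere n (theta : {RV P >-> n.-tuple R}) : Prop :=
  P [set w | enorm (theta w) = 1] = 1%E /\
  forall (Q : 'M[R]_n) (A : set (n.-tuple R)),
    Q *m Q^T = 1%:M -> measurable A ->
    P [set w | A (mulmx_tuple Q (theta w))] = P (theta @^-1` A).

Definition standard_gaussian d (eta : {RV P >-> d.-tuple R}) : Prop :=
  mutually_independent (fun (k : 'I_d) w => tnth (eta w) k) /\
  forall (k : 'I_d) (A : set R), measurable A ->
    P [set w | A (tnth (eta w) k)] = normal_prob (0 : R) (1 : R) A.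

Definition uniform_permutation r (p : {RV P >-> 'S_r}) : Prop :=
  forall s : 'S_r, P (p @^-1` [set s]) = ((r`!%:R)^-1)%:E.

End probability_notions.

Definition chi_squared (R : realType) (m : nat) (dT : measure_display)
    (T : measurableType dT) (P : probability T R) (Z : {RV P >-> R}) : Prop :=
  exists (dE : measure_display) (E : measurableType dE) (Q : probability E R)
    (eta : {RV Q >-> m.-tuple R}),
    standard_gaussian eta /\
    forall A : set R, measurable A ->
      P (Z @^-1` A) = Q [set w | A (enorm (eta w) ^+ 2)].

(* C is a valid constant in the Ayvazyan-Ulyanov theorem in dimension d, for
   confidence levels delta in D.  The theorem is usually quoted with
   D = ]0, 1[, but no finite constant works up to delta = 1: there the bound
   vanishes, while for n = 1 the left-hand side is a positive constant whenever
   xi_1 is discrete.  Keeping D general, C being uniform over D, makes the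
   notion satisfiable on ranges away from 1. *)
Definition ayvazyan_ulyanov_constant (R : realType) (D : set R) (d : nat)
    (C : R) : Prop :=
  forall (n : nat) (dT : measure_display) (T : measurableType dT)
    (P : probability T R)
    (xi : 'I_n.+1 -> {RV P >-> d.-tuple R})
    (theta : {RV P >-> n.+1.-tuple R})
    (k : R.-pker n.+1.-tuple R ~> d.-tuple R)
    (dE : measure_display) (E : measurableType dE) (Q : probability E R)
    (eta : {RV Q >-> d.-tuple R}),
  iid P xi ->
  (forall a : 'I_d, 'E_P[fun w => tnth (xi ord0 w) a] = 0)%E ->
  (forall a b : 'I_d,
    'E_P[fun w => (tnth (xi ord0 w) a * tnth (xi ord0 w) b)%R]
    = ((a == b)%:R : R)%:E)%E ->
  ('E_P[fun w => (enorm (xi ord0 w) ^+ 4)%R] < +oo)%E ->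
  uniform_on_sphere theta ->
  independent_of_family P theta xi ->
  standard_gaussian eta ->
  conditional_distribution
    (fun w => lincomb (theta w) (fun i => xi i w)) theta k ->
  forall delta : R, D delta ->
  with_probability_ge P (1 - delta)
    [set w | (ereal_sup
        [set `|k (theta w) B - Q (eta @^-1` B)|
          | B in [set B | measurable B /\ convex_tuple_set B]]
      <= (C * fine 'E_P[fun w' => (enorm (xi ord0 w') ^+ 4)%R]
          * ln (1 / delta) ^+ 2 / n.+1%:R)%:E)%E].

Section score.
Context {R : realType} {r : nat}.
Variable J : 'I_r -> R.

Definition score_mean : R := (\sum_(k < r) J k) / r%:R.

Definition score_var : R :=
  (\sum_(k < r) (J k - score_mean) ^+ 2) / (r.-1)%:R.

Definition score_vector (p : 'S_r) : r.-tuple R := [tuple J (p k) | k < r].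

Definition centered_score_vector (p : 'S_r) : r.-tuple R :=
  [tuple tnth (score_vector p) k - score_mean | k < r].

Definition score_statistic n (theta : n.-tuple R) (p : 'I_n -> 'S_r) : R :=
  score_var^-1 * enorm (lincomb theta (fun i => centered_score_vector (p i))) ^+ 2.

End score.

(* Main.v *)
(* Let c be the map from R^r to R^(r-1) given by the coordinates of the
   hyperplane of zero-sum vectors, and put xi_i = c (V_i - mean) / sigma.  The
   xi_i are i.i.d. and centered, their covariance is the identity and
   |xi_i|^2 = r - 1 surely, while T = |sum_i theta_i xi_i|^2.  Hence {T <= t} is
   the event that sum_i theta_i xi_i lies in a ball, which is convex, and the
   Ayvazyan-Ulyanov bound applies with E |xi|^4 = (r - 1)^2; finally
   (r - 1) sigma^2 <= r B^2 gives (r - 1)^2 <= r^2 B^2 / sigma^2.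
   Two points are implicit on paper.  The constant is nonnegative, because it
   bounds a nonnegative supremum on some outcome.  The conditional laws of T and
   of sum_i theta_i xi_i given theta are arbitrary versions, so they have to be
   matched for all t at once outside a single null set. *)
From HB Require Import structures.
Require Import Defs.
From mathcomp Require Import all_boot all_order all_algebra all_fingroup.
From mathcomp Require Import all_classical all_reals all_analysis.
From mathcomp Require Import measurable_realfun.
From mathcomp Require Import ring.

Set Implicit Arguments.
Unset Strict Implicit.
Unset Printing Implicit Defensive.

Import Order.TTheory GRing.Theory Num.Theory.

Local Open Scope classical_set_scope.
Local Open Scope ring_scope.

(** * Conditional laws given a random element: existence and uniqueness *)

Section random_map_kernel.
Context {R : realType} {dU dV dW : measure_display} {U : measurableType dU}
  {V : measurableType dV} {W : measurableType dW}.
Variables (mu : probability U R) (f : V * U -> W).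
Hypothesis mf : measurable_fun setT f.
Local Open Scope ereal_scope.

(** The law of [f (y, u)] for [u] drawn from [mu]. Composing a constant kernel with a Dirac kernel
    gives measurability in [y] for free. *)
Definition random_map_kernel : V -> {measure set W -> \bar R} :=
  mkcomp (kprobability (measurable_cst (mu : pprobability U R))) (kdirac mf).

HB.instance Definition _ := Kernel.on random_map_kernel.

Lemma random_map_kernelE y A : measurable A ->
  random_map_kernel y A = mu (xsection (f @^-1` A) y).
Proof.
move=> mA; rewrite /random_map_kernel /= /kcomp /= /kprobability /=.
under eq_integral do
  rewrite /kdirac /= /dirac /= -[X in X%:E]/(\1_A (f (y, _))).
have -> : (fun u => (\1_A (f (y, u)))%:E) =
          (fun u => (\1_(xsection (f @^-1` A) y) u)%:E : \bar R).
  by apply/funext => u; rewrite !indicE mem_xsection.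
rewrite integral_indic ?setIT//.
by apply: measurable_xsection; rewrite -[_ @^-1` _]setTI; exact: mf.
Qed.

Let random_map_kernel_prob y : random_map_kernel y setT = 1.
Proof.
rewrite random_map_kernelE// preimage_setT.
have -> : xsection [set: V * U] y = setT.
  by apply/seteqP; split=> u //= _; rewrite /xsection/= inE.
exact: probability_setT.
Qed.

HB.instance Definition _ := Kernel_isProbability.Build _ _ _ _ _
  random_map_kernel random_map_kernel_prob.

End random_map_kernel.

Section conditional_distributions.
Context {R : realType} {dT : measure_display} {T : measurableType dT}.
Variable P : probability T R.
Local Open Scope ereal_scope.

(** Freezing: by independence the joint law of [Y] and [X] is a product measure, whose value on a
    set is the integral over [y] of its sections. *)
Lemma conditional_distribution_random_map {dU dV dW} {U : measurableType dU}
    {V : measurableType dV} {W : measurableType dW}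
    (Y : {RV P >-> V}) (X : {RV P >-> U}) (f : V * U -> W)
    (mf : measurable_fun setT f) :
  independent P Y X ->
  conditional_distribution (fun w => f (Y w, X w)) Y
    (random_map_kernel (distribution P X) mf).
Proof.
move=> YX A B mA mB.
have mYX : measurable_fun setT (fun w => (Y w, X w)).
  by apply: measurable_fun_pair.
pose YXm := HB.pack_for {mfun T >-> (V * U)%type} (fun w => (Y w, X w))
  (isMeasurableFun.Build _ _ _ _ _ mYX).
have mfB : measurable (f @^-1` B) by rewrite -[_ @^-1` _]setTI; exact: mf.
have mAB : measurable ((A `*` setT) `&` (f @^-1` B)).
  by apply: measurableI => //; exact: measurableX.
have <- : distribution P YXm (A `*` setT `&` f @^-1` B) =
    P (Y @^-1` A `&` (fun w => f (Y w, X w)) @^-1` B).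
  by congr (P _); apply/seteqP; split=> w /= [] // [].
rewrite -(@product_measure_unique _ _ _ _ _ (distribution P Y)
  (distribution P X) (distribution P YXm))//.
rewrite integral_mkcond /product_measure1.
apply: eq_integral => y _.
rewrite patchE random_map_kernelE//=.
case: ifPn => [yA|yA].
  congr (_ _); apply/seteqP; split=> u; rewrite /xsection/= !inE => //=.
    by case.
  by split => //; split=> //; move: yA; rewrite inE.
rewrite (_ : xsection _ _ = set0) ?measure0//.
rewrite notin_setE in yA.
by apply/seteqP; split=> u; rewrite /xsection/= ?inE => //= -[[/yA]].
Qed.

(** Both functions are densities of the same measure with respect to the law of [Y]. The bounds on
    [f] make it integrable, as uniqueness of densities requires. *)
Lemma ae_eq_conditional_probability {dV} {V : measurableType dV}
    (Y : {RV P >-> V}) (E : set T) (f g : V -> \bar R) :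
  measurable_fun [set: V] f -> measurable_fun [set: V] g ->
  (forall y, 0 <= f y <= 1) ->
  (forall A, measurable A ->
    P (Y @^-1` A `&` E) = \int[distribution P Y]_(y in A) f y) ->
  (forall A, measurable A ->
    P (Y @^-1` A `&` E) = \int[distribution P Y]_(y in A) g y) ->
  {ae distribution P Y, forall y, f y = g y}.
Proof.
move=> mf mg f01 hf hg.
have fi : (distribution P Y).-integrable setT f.
  apply: (le_integrable _ _ _
    (finite_measure_integrable_cst (distribution P Y) 1 measurableT)) => //.
  by move=> y _ /=; rewrite normr1 gee0_abs; have /andP[] := f01 y.
have [N [mN N0 sN]] : ae_eq (distribution P Y) setT f g.
  by apply: integral_ae_eq => // A _ mA; rewrite -hf ?hg.
exists N; split => // y /= fgy; apply: sN => /= fg; apply: fgy; exact: fg.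
Qed.

End conditional_distributions.

(** * Matching conditional laws on all rays at once *)

Section rays.
Context {R : realType}.
Local Open Scope ereal_scope.

(** The ray at [t] is the increasing union of the rays at [t + 1/(n+1)], and a rational ray fits
    between each of these and the ray at [t]. *)
Lemma measure_ray_le (m1 m2 : {measure set R -> \bar R}) :
  (forall q : rat, m1 `]ratr q, +oo[%classic = m2 `]ratr q, +oo[%classic) ->
  forall t, m1 `]t, +oo[%classic <= m2 `]t, +oo[%classic.
Proof.
move=> m12 t.
have cv : m1 `](t + n.+1%:R^-1)%R, +oo[%classic @[n --> \oo] -->
    m1 `]t, +oo[%classic.
  rewrite (_ : `]t, +oo[%classic =
      \bigcup_n `](t + n.+1%:R^-1)%R, +oo[%classic).
    apply: nondecreasing_cvg_mu => //.
      by apply: bigcup_measurable.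
    move=> m n mn; apply/subsetPset; apply: subset_itvr.
    by rewrite bnd_simp lerD2l lef_pV2 ?posrE// ler_nat.
  apply/seteqP; split=> x /=; rewrite in_itv/= andbT.
    move=> tx. have /ltr_add_invr[n nx] := tx.
    by exists n => //=; rewrite in_itv/= andbT.
  case=> n _ /=; rewrite in_itv/= andbT; apply: lt_trans.
  by rewrite ltrDl invr_gt0.
rewrite -(cvg_lim _ cv)//; apply: lime_le.
  by apply/cvg_ex; eexists; exact: cv.
apply: nearW => n.
have [|q] := @rat_in_itvoo _ t (t + n.+1%:R^-1)%R.
  by rewrite ltrDl invr_gt0.
rewrite in_itv/= => /andP[tq qn].
apply: (@le_trans _ _ (m1 `]ratr q, +oo[%classic)).
  apply: le_measure; rewrite ?inE//; apply: subset_itvr.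
  by rewrite bnd_simp ltW.
rewrite m12; apply: le_measure; rewrite ?inE//; apply: subset_itvr.
by rewrite bnd_simp ltW.
Qed.

Lemma eq_measure_rays (m1 m2 : {measure set R -> \bar R}) :
  (forall q : rat, m1 `]ratr q, +oo[%classic = m2 `]ratr q, +oo[%classic) ->
  forall t, m1 `]t, +oo[%classic = m2 `]t, +oo[%classic.
Proof.
by move=> m12 t; apply/eqP; rewrite eq_le !measure_ray_le// => q; rewrite m12.
Qed.
End rays.

Section random_variables.
Context {R : realType} {dT : measure_display} {T : measurableType dT}.
Variable P : probability T R.
Local Open Scope ereal_scope.

(** For a fixed ray the two versions agree outside a null set; the union of these sets over rational
    endpoints is still null, and rational rays determine all rays. *)
Lemma ae_eq_conditional_rays {dU dV} {U : measurableType dU}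
    {V : measurableType dV} (Y : {RV P >-> V}) (X : T -> U) (g : U -> R)
    (k1 : R.-pker V ~> R) (k2 : R.-pker V ~> U) :
  measurable_fun setT g ->
  conditional_distribution (g \o X) Y k1 -> conditional_distribution X Y k2 ->
  {ae distribution P Y, forall y, forall t,
    k1 y `]t, +oo[%classic = k2 y (g @^-1` `]t, +oo[%classic)}.
Proof.
move=> mg k1X k2X.
have mgr t : measurable (g @^-1` `]t, +oo[%classic).
  by rewrite -[_ @^-1` _]setTI; exact: mg.
pose gm := HB.pack_for {mfun U >-> R} g (isMeasurableFun.Build _ _ _ _ _ mg).
(* Rationals are enumerated by their codes, so that a countable intersection applies; an [n] that
   codes no rational imposes nothing. *)
suff : {ae distribution P Y, forall y, forall n : nat,
    if unpickle n is Some q then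
      k1 y `](ratr (q : rat)), +oo[%classic =
      k2 y (g @^-1` `](ratr q), +oo[%classic)
    else True}.
  apply: filterS => y k12 t.
  apply: (@eq_measure_rays _ (k1 y) (pushforward (k2 y) gm)) => q.
  by have := k12 (pickle q); rewrite pickleK.
apply: ae_foralln => n; case: unpickle => [q|]; last exact: aeW.
apply: (@ae_eq_conditional_probability _ _ _ _ _ _ Y
    ((g \o X) @^-1` `](ratr q), +oo[%classic)).
- exact: measurable_kernel.
- exact: measurable_kernel.
- move=> y; rewrite measure_ge0/=.
  have <- : k1 y setT = 1 by exact: prob_kernel.
  by apply: le_measure; rewrite ?inE.
- by move=> A mA; rewrite k1X.
- by move=> A mA; rewrite comp_preimage k2X.
Qed.

Lemma expectation_uniform_permutation r (p : {RV P >-> 'S_r})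
    (f : 'S_r -> R) : uniform_permutation p ->
  'E_P[f \o p] = ((\sum_s f s) / r`!%:R)%:E.
Proof.
move=> p_unif.
have mp s : measurable (p @^-1` [set s]).
  by rewrite -[_ @^-1` _]setTI; exact: measurable_funP.
have -> : f \o p = (fun w => \sum_s (f s * \1_(p @^-1` [set s]) w))%R.
  apply/funext => w /=; rewrite (bigD1 (p w))//= big1 ?addr0.
    by rewrite indicE mem_set// mulr1.
  move=> s spw; rewrite indicE memNset ?mulr0//= => pws.
  by rewrite pws eqxx in spw.
rewrite unlock.
under eq_integral do rewrite -sumEFin.
rewrite integral_sum//; last first.
  move=> s; under eq_fun do rewrite EFinM.
  apply: integrableZl => //; exact: integrable_indic.
rewrite mulr_suml -sumEFin; apply: eq_bigr => s _.
under eq_integral do rewrite EFinM.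
rewrite integralZl//; last exact: integrable_indic.
by rewrite integral_indic// setIT EFinM; congr (_ * _); exact: p_unif.
Qed.

End random_variables.

(** * First and second moments of a uniformly permuted zero-sum vector *)

Section permutation_sums.
Context {F : numFieldType} {r : nat}.
Variable c : 'I_r -> F.
Hypothesis c_sum0 : \sum_k c k = 0.

Let cov k l := \sum_(s : 'S_r) c (s k) * c (s l).

Let cov_perm (t : 'S_r) k l : cov (t k) (t l) = cov k l.
Proof.
rewrite /cov [RHS](reindex_inj (mulgI t))/=.
by apply: eq_bigr => s _; rewrite !permM.
Qed.

Let sum_perm (f : 'I_r -> F) (s : 'S_r) : \sum_k f (s k) = \sum_k f k.
Proof. by rewrite [RHS](reindex_inj (@perm_inj _ s)). Qed.

Let sum_cst (x : F) : \sum_(k < r) x = r%:R * x.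
Proof. by rewrite sumr_const card_ord mulr_natl. Qed.

Lemma sum_perm_score k : \sum_(s : 'S_r) c (s k) = 0.
Proof.
have rn0 : r%:R != 0 :> F.
  by rewrite pnatr_eq0 -lt0n (leq_ltn_trans _ (ltn_ord k)).
apply: (mulfI rn0); rewrite mulr0 -sum_cst.
(* Reindexing by a transposition turns the [l]-th of the [r] equal copies into the sum of [c (s l)];
   summing over [l] first then gives zero. *)
under eq_bigr => l _.
  rewrite (reindex_inj (mulgI (tperm k l)))/=.
  under eq_bigr do rewrite permM tpermL.
  over.
by rewrite exchange_big/= big1// => s _; rewrite sum_perm.
Qed.

(** By symmetry all diagonal entries are equal, and so are all off-diagonal ones. The sum of squares
    fixes the former, and the vanishing row sums then fix the latter. *)
Lemma sum_perm_score2 k l : (1 < r)%N ->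
  \sum_(s : 'S_r) c (s k) * c (s l) =
  r`!%:R * ((\sum_j c j ^+ 2) / r.-1%:R) * ((k == l)%:R - r%:R^-1).
Proof.
move=> r1; rewrite -/(cov k l).
have rn0 : r%:R != 0 :> F by rewrite pnatr_eq0 -lt0n (ltn_trans _ r1).
have rE : r%:R = r.-1%:R + 1 :> F by rewrite natr1 prednK// (ltn_trans _ r1).
have r1n0 : r.-1%:R != 0 :> F.
  by rewrite pnatr_eq0 -lt0n -ltnS prednK// (ltn_trans _ r1).
have covkk : r%:R * cov k k = r`!%:R * (\sum_j c j ^+ 2).
  rewrite -sum_cst.
  under eq_bigr => j _.
    rewrite -(cov_perm (tperm k j)) tpermL; over.
  rewrite exchange_big/=.
  under eq_bigr => s _.
    rewrite (eq_bigr (fun j => c (s j) ^+ 2)) => [|j _]; last by rewrite expr2.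
    rewrite (sum_perm (fun j => c j ^+ 2)); over.
  by rewrite sumr_const card_Sn mulr_natl.
have cov0 : \sum_j cov k j = 0.
  rewrite exchange_big/= big1// => s _.
  by rewrite -mulr_sumr (sum_perm c) c_sum0 mulr0.
have covkk' : cov k k = r`!%:R * (\sum_j c j ^+ 2) / r%:R.
  by rewrite -covkk mulrC mulKf.
case: eqVneq => [<-|kl].
  by rewrite covkk' rE mulr1n; field; rewrite -rE rn0.
have covkl : r.-1%:R * cov k l = - cov k k.
  apply/eqP; rewrite -addr_eq0 addrC -cov0 (bigD1 k)//=.
  rewrite [X in _ == _ + X](_ : _ = r.-1%:R * cov k l)//.
  (* The transposition of [l] and [j] fixes [k], so the [r - 1] off-diagonal entries of the row
     coincide. *)
  rewrite (eq_bigr (fun=> cov k l)) => [|j jk].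
    by rewrite sumr_const cardC1 card_ord mulr_natl.
  by rewrite -(cov_perm (tperm l j) k l) tpermL tpermD// eq_sym.
apply: (mulfI r1n0); rewrite covkl covkk' rE mulr0n sub0r; field.
by rewrite -rE rn0.
Qed.

End permutation_sums.

(** * Isometric coordinates on the hyperplane of zero-sum vectors *)

Section hyperplane_coordinates.
Context {R : realType} {m : nat}.

Let e : R := (Num.sqrt m.+2%:R - 1)^-1.

Let eE : m.+1%:R * e ^+ 2 = 1 + 2 * e.
Proof.
have s2 : Num.sqrt m.+2%:R ^+ 2 = m.+1%:R + 1 :> R by rewrite sqr_sqrtr// natr1.
have s1 : Num.sqrt m.+2%:R - 1 != 0 :> R.
  apply/eqP => /subr0_eq s; move: s2.
  by rewrite s expr1n -[LHS]add0r => /addIr/esym/eqP; rewrite pnatr_eq0.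
have -> : m.+1%:R = Num.sqrt m.+2%:R ^+ 2 - 1 :> R by rewrite s2 addrK.
by rewrite /e; field.
Qed.

(* In these coordinates the hyperplane of vectors of zero sum is isometric to
   R^(m+1): the constant e is the positive root of (m+1) e^2 = 1 + 2 e. *)
Definition hyperplane_coords (x : m.+2.-tuple R) : m.+1.-tuple R :=
  [tuple tnth x (lift ord0 a) + e * tnth x ord0 | a < m.+1].

Lemma enorm_hyperplane_coords x : \sum_k tnth x k = 0 ->
  enorm (hyperplane_coords x) = enorm x.
Proof.
rewrite big_ord_recl => x0.
have {}x0 : \sum_(a < m.+1) tnth x (lift ord0 a) = - tnth x ord0.
  by apply/eqP; rewrite -addr_eq0 addrC x0.
rewrite /enorm; congr Num.sqrt.
under eq_bigr do rewrite tnth_mktuple sqrrD.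
rewrite !big_split/= sumr_const card_ord [RHS]big_ord_recl.
(* With [x0] the cross term contributes [-2 e] times the square of the first coordinate, and [eE]
   turns the last term into [1 + 2 e] times it; what remains is that square itself. *)
rewrite -!mulr_suml x0 exprMn -[_ *+ m.+1]mulr_natl [m.+1%:R * _]mulrA eE; ring.
Qed.

Lemma lincomb_hyperplane_coords n (a : n.-tuple R) (x : 'I_n -> m.+2.-tuple R) :
  lincomb a (fun i => hyperplane_coords (x i)) =
  hyperplane_coords (lincomb a x).
Proof.
apply: eq_from_tnth => b; rewrite !tnth_mktuple mulr_sumr -big_split/=.
by apply: eq_bigr => i _; rewrite tnth_mktuple; ring.
Qed.

(** The covariance of the permuted vector is a multiple of the orthogonal projection onto the
    hyperplane, which becomes the identity in isometric coordinates. *)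
Lemma sum_perm_hyperplane_coords (c : 'I_m.+2 -> R) (a b : 'I_m.+1) :
  \sum_k c k = 0 ->
  \sum_(s : 'S_m.+2) tnth (hyperplane_coords [tuple c (s k) | k < m.+2]) a *
    tnth (hyperplane_coords [tuple c (s k) | k < m.+2]) b =
  m.+2`!%:R * ((\sum_j c j ^+ 2) / m.+1%:R) * (a == b)%:R.
Proof.
move=> c0.
under eq_bigr do rewrite !tnth_mktuple mulrDl !mulrDr.
rewrite !big_split/= sum_perm_score2//.
set K := _ * (_ / _).
have cov k l : \sum_(s : 'S_m.+2) c (s k) * c (s l) =
    K * ((k == l)%:R - m.+2%:R^-1) by exact: sum_perm_score2.
under [X in _ + X + _]eq_bigr do rewrite mulrCA.
under [X in _ + (X + _)]eq_bigr do rewrite -mulrA.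
under [X in _ + (_ + X)]eq_bigr do rewrite mulrACA.
rewrite -!mulr_sumr !cov (inj_eq lift_inj) eqxx.
rewrite [lift _ _ == _]eq_sym !(negbTE (neq_lift _ _)) mulr0n mulr1n.
(* This is [eE] divided by [m + 2]; it cancels every term of the expansion except the Kronecker
   delta. *)
have eE' : e ^+ 2 * (1 - m.+2%:R^-1) = m.+2%:R^-1 * (1 + 2 * e).
  by rewrite -eE -[m.+2%:R]natr1; field.
transitivity (K * ((a == b)%:R - m.+2%:R^-1 - 2 * e * m.+2%:R^-1 +
    e ^+ 2 * (1 - m.+2%:R^-1))); first by ring.
by rewrite eE'; ring.
Qed.

End hyperplane_coordinates.

(** * Euclidean balls and complements of events *)

Section euclidean_norm.
Context {R : realType} {d : nat}.

Lemma sqr_enorm (x : d.-tuple R) : enorm x ^+ 2 = \sum_(k < d) tnth x k ^+ 2.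
Proof. by rewrite sqr_sqrtr// sumr_ge0// => k _; exact: sqr_ge0. Qed.

Lemma enormZ (a : R) (x : d.-tuple R) :
  enorm [tuple a * tnth x k | k < d] = `|a| * enorm x.
Proof.
rewrite /enorm; under eq_bigr do rewrite tnth_mktuple exprMn.
by rewrite -mulr_sumr sqrtrM ?sqr_ge0// sqrtr_sqr.
Qed.

Lemma measurable_sqr_enorm :
  measurable_fun setT (fun x : d.-tuple R => enorm x ^+ 2).
Proof.
under eq_fun do rewrite sqr_enorm.
by apply: measurable_sum => k; apply: measurable_funX; exact: measurable_tnth.
Qed.

Lemma convex_ball (t : R) :
  convex_tuple_set [set x : d.-tuple R | enorm x ^+ 2 <= t].
Proof.
move=> x y u /=; rewrite !sqr_enorm => xt yt /andP[u0 u1].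
under eq_bigr do rewrite tnth_mktuple.
have -> : t = u * t + (1 - u) * t by ring.
apply: (@le_trans _ _ (u * (\sum_(k < d) tnth x k ^+ 2) +
    (1 - u) * (\sum_(k < d) tnth y k ^+ 2))).
  rewrite !mulr_sumr -big_split/=; apply: ler_sum => k _; rewrite -subr_ge0.
  (* The convexity defect of the square, coordinate by coordinate. *)
  rewrite (_ : _ - _ = u * (1 - u) * (tnth x k - tnth y k) ^+ 2); last by ring.
  by apply: mulr_ge0 (sqr_ge0 _); rewrite mulr_ge0 ?subr_ge0.
by apply: lerD; apply: ler_wpM2l; rewrite ?subr_ge0.
Qed.

End euclidean_norm.

Lemma abse_sub_setC {R : realType} {d} {T : measurableType d}
    (m1 m2 : {measure set T -> \bar R}) (A : set T) :
  m1 setT = 1%E -> m2 setT = 1%E -> measurable A ->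
  (`|m1 (~` A) - m2 (~` A)| = `|m1 A - m2 A|)%E.
Proof.
move=> m11 m21 mA.
have mE (m : {measure set T -> \bar R}) : m setT = 1%E ->
    exists2 a : R, m A = a%:E & m (~` A) = (1 - a)%:E.
  move=> m1T.
  have mAE : (m A + m (~` A))%E = 1%E.
    by rewrite -measureU ?setICr// ?setUv//; exact: measurableC.
  have := measure_ge0 m A; have := measure_ge0 m (~` A); move: mAE.
  case: (m A) => [a| |]//; case: (m (~` A)) => [b| |]// [ab] _ _.
  by exists a => //; congr EFin; rewrite -ab; ring.
have [a -> ->] := mE _ m11; have [b -> ->] := mE _ m21.
by rewrite -!EFinB /= distrC; congr (`|_|%:E); ring.
Qed.

(** * Standardized score vectors in dimension [r - 1] *)

Section standardized_score.
Context {R : realType} {m : nat} (J : 'I_m.+2 -> R).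
Hypothesis J_var : 0 < score_var J.

Definition standardized_score (s : 'S_m.+2) : m.+1.-tuple R :=
  [tuple (Num.sqrt (score_var J))^-1 *
    tnth (hyperplane_coords (centered_score_vector J s)) a | a < m.+1].

Let c k := J k - score_mean J.

Let c_sum0 : \sum_k c k = 0.
Proof.
by rewrite sumrB sumr_const card_ord -mulr_natr divfK ?subrr.
Qed.

Let centered_scoreE s :
  centered_score_vector J s = [tuple c (s k) | k < m.+2].
Proof. by apply: eq_from_tnth => k; rewrite !tnth_mktuple. Qed.

Let centered_score_sum0 s : \sum_k tnth (centered_score_vector J s) k = 0.
Proof.
rewrite centered_scoreE; under eq_bigr do rewrite tnth_mktuple.
by rewrite -[RHS]c_sum0 [RHS](reindex_inj (@perm_inj _ s)).
Qed.

Let sum_sqr_c : \sum_k c k ^+ 2 = score_var J * m.+1%:R.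
Proof. by rewrite /score_var /= divfK ?pnatr_eq0. Qed.

Let sd_neq0 : Num.sqrt (score_var J) != 0.
Proof. by rewrite gt_eqF// sqrtr_gt0. Qed.

(** The product of [r - 1 <= r] with [(r - 1) sigma^2 <= r B^2], the latter because the left side is
    a sum of [r] squares. *)
Lemma score_var_le B : (forall k, `|J k - score_mean J| <= B) ->
  m.+1%:R ^+ 2 * score_var J <= m.+2%:R ^+ 2 * B ^+ 2.
Proof.
move=> JB; rewrite expr2 -mulrA [_ * score_var J]mulrC -sum_sqr_c expr2 -mulrA.
have B2 : \sum_k c k ^+ 2 <= m.+2%:R * B ^+ 2.
  rewrite mulr_natl -[X in _ *+ X]card_ord -sumr_const.
  by apply: ler_sum => k _; rewrite -[leLHS]real_normK ?num_real//
    lerXn2r ?nnegrE// (le_trans _ (JB k)).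
apply: ler_pM => //; last by rewrite ler_nat.
by rewrite sumr_ge0// => k _; exact: sqr_ge0.
Qed.

Lemma sum_standardized_score a : \sum_s tnth (standardized_score s) a = 0.
Proof.
under eq_bigr do rewrite tnth_mktuple centered_scoreE tnth_mktuple.
rewrite -mulr_sumr big_split/= -mulr_sumr.
under eq_bigr do rewrite tnth_mktuple.
under [X in _ + _ * X]eq_bigr do rewrite tnth_mktuple.
by rewrite !sum_perm_score// mulr0 addr0 mulr0.
Qed.

Lemma sum_standardized_score2 a b :
  \sum_s tnth (standardized_score s) a * tnth (standardized_score s) b =
  m.+2`!%:R * (a == b)%:R.
Proof.
under eq_bigr do
  rewrite tnth_mktuple [X in _ * X]tnth_mktuple mulrACA !centered_scoreE.
rewrite -mulr_sumr sum_perm_hyperplane_coords// sum_sqr_c mulfK//.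
rewrite -invfM -expr2 sqr_sqrtr ?ltW//.
by rewrite [X in _ * X]mulrAC mulrC mulfK// gt_eqF.
Qed.

(** A permutation only reorders the centered scores, so the norm does not depend on [s]; this makes
    the fourth moment explicit. *)
Lemma sqr_enorm_standardized_score s :
  enorm (standardized_score s) ^+ 2 = m.+1%:R.
Proof.
rewrite enormZ enorm_hyperplane_coords// exprMn sqr_enorm.
rewrite real_normK ?num_real//.
rewrite exprVn sqr_sqrtr ?ltW// centered_scoreE.
under eq_bigr do rewrite tnth_mktuple.
rewrite -(reindex_inj (@perm_inj _ s) (P := predT) (F := fun k => c k ^+ 2))/=.
by rewrite sum_sqr_c mulrA mulVf ?mul1r// gt_eqF.
Qed.

(** The coordinate map is linear, and it preserves the norm of the combination because a combination
    of zero-sum vectors has zero sum. *)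
Lemma score_statisticE n (theta : n.-tuple R) (p : 'I_n -> 'S_m.+2) :
  score_statistic J theta p =
  enorm (lincomb theta (fun i => standardized_score (p i))) ^+ 2.
Proof.
set x := fun i => centered_score_vector J (p i).
have -> : lincomb theta (fun i => standardized_score (p i)) =
    [tuple (Num.sqrt (score_var J))^-1 *
      tnth (hyperplane_coords (lincomb theta x)) a | a < m.+1].
  apply: eq_from_tnth => a.
  rewrite -lincomb_hyperplane_coords !tnth_mktuple mulr_sumr.
  by apply: eq_bigr => i _; rewrite tnth_mktuple mulrCA.
rewrite enormZ enorm_hyperplane_coords.
  by rewrite exprMn real_normK ?num_real// exprVn sqr_sqrtr// ltW.
under eq_bigr do rewrite tnth_mktuple.
rewrite exchange_big/= big1// => i _.
by rewrite -mulr_sumr centered_score_sum0 mulr0.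
Qed.

End standardized_score.

Lemma measurable_mktuple {dU dV} {U : measurableType dU} {V : measurableType dV}
    n (f : 'I_n -> U -> V) : (forall i, measurable_fun setT (f i)) ->
  measurable_fun setT (fun x => [tuple f i x | i < n]).
Proof.
move=> mf; apply/measurable_fun_tnthP => i.
rewrite (_ : _ \o _ = f i)//.
by apply/funext => x /=; rewrite tnth_mktuple.
Qed.

Lemma measurable_lincomb_comp {R : realType} {dU} {U : measurableType dU} n d
    (f : U -> d.-tuple R) : measurable_fun setT f ->
  measurable_fun setT (fun yu : n.-tuple R * n.-tuple U =>
    lincomb yu.1 (fun i => f (tnth yu.2 i))).
Proof.
move=> mf; apply: measurable_mktuple => b; apply: measurable_sum => i.
apply: measurable_funM.
  by apply: (measurableT_comp (measurable_tnth i)); exact: measurable_fst.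
apply: (measurableT_comp (measurable_tnth b)); apply: (measurableT_comp mf).
by apply: (measurableT_comp (measurable_tnth i)); exact: measurable_snd.
Qed.

Lemma measurable_perm_fun {I : finType} {d} {U : measurableType d}
    (f : {perm I} -> U) : measurable_fun setT f.
Proof. by []. Qed.

(** * Gaussian approximation on balls and the resulting chi-squared bound *)

Section score_statistic_bound.
Context {R : realType} (m n : nat) (J : 'I_m.+2 -> R).
Hypothesis J_var : 0 < score_var J.
Context {dT : measure_display} {T : measurableType dT} (P : probability T R).
Variables (p : 'I_n.+1 -> {RV P >-> 'S_m.+2})
  (theta : {RV P >-> n.+1.-tuple R}).
Hypotheses (p_iid : iid P p) (p_unif : forall i, uniform_permutation (p i)).
Hypotheses (theta_unif : uniform_on_sphere theta)
  (theta_indep : independent_of_family P theta p).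

Let xi_measurable i : measurable_fun setT (standardized_score J \o p i).
Proof. exact: (measurableT_comp (measurable_perm_fun _)). Qed.

Let xi i : {RV P >-> m.+1.-tuple R} :=
  HB.pack_for {mfun T >-> m.+1.-tuple R} (standardized_score J \o p i)
    (isMeasurableFun.Build _ _ _ _ _ (xi_measurable i)).

Let p_tuple_measurable :
  measurable_fun setT (fun w => [tuple p i w | i < n.+1]).
Proof.
by apply: measurable_mktuple.
Qed.

Let p_tuple : {RV P >-> n.+1.-tuple 'S_m.+2} :=
  HB.pack_for {mfun T >-> n.+1.-tuple 'S_m.+2}
    (fun w => [tuple p i w | i < n.+1])
    (isMeasurableFun.Build _ _ _ _ _ p_tuple_measurable).

Let xi_iid : iid P xi.
Proof.
have mS (A : set (m.+1.-tuple R)) : measurable (standardized_score J @^-1` A).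
  by [].
case: p_iid => p_ind p_id; split=> [I A mA|i j A mA].
  exact: (p_ind I (fun i => standardized_score J @^-1` A i)).
exact: (p_id i j (standardized_score J @^-1` A)).
Qed.

Let xi_indep : independent_of_family P theta xi.
Proof.
move=> A B mA mB.
pose f (s : n.+1.-tuple 'S_m.+2) :=
  [tuple standardized_score J (tnth s i) | i < n.+1].
have mf : measurable_fun setT f.
  apply: measurable_mktuple => i.
  exact: (measurableT_comp (measurable_perm_fun _) (measurable_tnth i)).
have -> : (fun w => [tuple xi i w | i < n.+1]) = f \o p_tuple.
  by apply/funext => w; apply: eq_from_tnth => i; rewrite !tnth_mktuple.
have mfB : measurable (f @^-1` B) by rewrite -[_ @^-1` _]setTI; exact: mf.
exact: (theta_indep mA mfB).
Qed.

Let xi_mean a : ('E_P[fun w => tnth (xi ord0 w) a] = 0)%E.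
Proof.
rewrite (expectation_uniform_permutation
  (fun s => tnth (standardized_score J s) a) (p_unif ord0)).
by rewrite sum_standardized_score// mul0r.
Qed.

Let xi_cov a b :
  ('E_P[fun w => (tnth (xi ord0 w) a * tnth (xi ord0 w) b)%R] =
   ((a == b)%:R : R)%:E)%E.
Proof.
rewrite (expectation_uniform_permutation (fun s =>
  tnth (standardized_score J s) a * tnth (standardized_score J s) b)
  (p_unif ord0)).
by rewrite sum_standardized_score2// mulrC mulKf// pnatr_eq0 -lt0n fact_gt0.
Qed.

Let xi_norm4 :
  ('E_P[fun w => (enorm (xi ord0 w) ^+ 4)%R] = (m.+1%:R ^+ 2)%:E)%E.
Proof.
under eq_fun do rewrite (exprM _ 2 2) sqr_enorm_standardized_score//.
exact: expectation_cst.
Qed.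

Let lincomb_xi_kernel : R.-pker n.+1.-tuple R ~> m.+1.-tuple R :=
  random_map_kernel (distribution P p_tuple)
    (measurable_lincomb_comp (n := n.+1)
      (measurable_perm_fun (standardized_score J))).

Let lincomb_xi_kernelP :
  conditional_distribution (fun w => lincomb (theta w) (fun i => xi i w)) theta
    lincomb_xi_kernel.
Proof.
have := conditional_distribution_random_map (X := p_tuple)
  (measurable_lincomb_comp (n := n.+1)
    (measurable_perm_fun (standardized_score J))) theta_indep.
congr conditional_distribution; apply/funext => w /=; congr lincomb.
by apply/funext => i; rewrite tnth_mktuple.
Qed.

Lemma score_statistic_bound (D : set R) (C : R)
    (hD : D `<=` [set delta | 0 < delta < 1])
    (hC : ayvazyan_ulyanov_constant D m.+1 C)
    (B : R) (hB : forall k, `|J k - score_mean J| <= B)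
    (k : R.-pker n.+1.-tuple R ~> R)
    (hk : conditional_distribution
      (fun w => score_statistic J (theta w) (fun i => p i w)) theta k)
    (dE : measure_display) (E : measurableType dE) (Q : probability E R)
    (Z : {RV Q >-> R}) (hZ : chi_squared m.+1 Z)
    (delta : R) (hdelta : D delta) :
  with_probability_ge P (1 - delta)
    [set w | (ereal_sup
        (range (fun t : R =>
          `|k (theta w) [set x : R | (t < x)%R] - Q [set v | (t < Z v)%R]|))
      <= (C * m.+2%:R ^+ 2 * B ^+ 2 * ln (1 / delta) ^+ 2
          / (score_var J * n.+1%:R))%:E)%E].
Proof.
case: hZ => dE' [E' [Q' [eta [eta_gauss ZE]]]].
have [|A [mA AS PA]] := hC n dT T P xi theta lincomb_xi_kernel dE' E' Q' eta
  xi_iid xi_mean xi_cov _ theta_unif xi_indep eta_gauss lincomb_xi_kernelP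
  delta hdelta.
  by rewrite xi_norm4 ltry.
have hk' : conditional_distribution ((fun x => enorm x ^+ 2) \o
    (fun w => lincomb (theta w) (fun i => xi i w))) theta k.
  by move: hk; congr conditional_distribution; apply/funext => w /=;
    rewrite score_statisticE.
have [N [mN N0 NS]] := ae_eq_conditional_rays (measurable_sqr_enorm (d := m.+1))
  hk' lincomb_xi_kernelP.
have mtN : measurable (theta @^-1` N).
  by rewrite -[_ @^-1` _]setTI; exact: measurable_funP.
(* The good event, minus the outcomes where [theta] falls in the null set on which [k] and the
   explicit kernel may disagree on some ray. *)
exists (A `\` theta @^-1` N); split; first exact: measurableD.
- move=> w [Aw Nw]; have /= Sw := AS _ Aw; rewrite xi_norm4 /= in Sw.
  have kE : forall t, k (theta w) `]t, +oo[%classic =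
      lincomb_xi_kernel (theta w)
        ((fun x => enorm x ^+ 2) @^-1` `]t, +oo[%classic).
    by apply: contrapT => kE; apply: Nw; apply: NS.
  have ln_gt0 : 0 < ln (1 / delta) ^+ 2.
    have /= /andP[d0 d1] := hD _ hdelta.
    by rewrite exprn_gt0// ln_gt0// div1r invf_gt1.
  (* The sign is read off at the present outcome: the whole space is convex, so the supremum is at
     least a nonnegative term, and the factors multiplying [C] are positive. *)
  have C0 : 0 <= C.
    have : (0 <= (C * m.+1%:R ^+ 2 * ln (1 / delta) ^+ 2 / n.+1%:R)%:E)%E.
      apply: le_trans Sw; apply: le_ereal_sup_tmp.
      by eexists; [exists setT; [split|reflexivity]|exact: abse_ge0].
    by rewrite lee_fin !pmulr_lge0 ?invr_gt0.
  apply: ge_ereal_sup => _ [t _ <-].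
  pose ball := [set x : m.+1.-tuple R | enorm x ^+ 2 <= t].
  have mball : measurable ball.
    have -> : ball = (fun x => enorm x ^+ 2) @^-1` `]-oo, t]%classic.
      by apply/seteqP; split=> x /=; rewrite in_itv.
    by rewrite -[_ @^-1` _]setTI; exact: measurable_sqr_enorm.
  have ballC : (fun x => enorm x ^+ 2) @^-1` `]t, +oo[%classic = ~` ball.
    by apply/seteqP; split=> x /=; rewrite in_itv/= andbT ltNge => /negP.
  have -> : [set x : R | t < x] = `]t, +oo[%classic.
    by apply/seteqP; split=> x /=; rewrite in_itv/= andbT.
  rewrite kE ballC.
  have -> : Q [set v | t < Z v] = Q' (eta @^-1` (~` ball)).
    rewrite -ballC; transitivity (Q (Z @^-1` `]t, +oo[%classic)).
      by congr (Q _); apply/seteqP; split=> v /=; rewrite in_itv/= andbT.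
    by rewrite ZE.
  (* The event that the statistic exceeds [t] is the complement of a ball; passing to complements
     keeps the discrepancy and reaches a convex set. *)
  apply: (@le_trans _ _
      `|lincomb_xi_kernel (theta w) ball - distribution Q' eta ball|%E).
    rewrite -abse_sub_setC//; [exact: prob_kernel|exact: probability_setT].
  apply: (le_trans (ereal_sup_ubound _) (le_trans Sw _)).
    by exists ball => //; split=> //; exact: convex_ball.
  rewrite lee_fin.
  (* The bound is regrouped so that only [(r - 1)^2 <= r^2 B^2 / sigma^2] remains to be compared. *)
  rewrite (_ : C * m.+2%:R ^+ 2 * B ^+ 2 * ln (1 / delta) ^+ 2 /
      (score_var J * n.+1%:R) =
    C * (m.+2%:R ^+ 2 * B ^+ 2 / score_var J) * ln (1 / delta) ^+ 2 / n.+1%:R).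
    apply: ler_wpM2r; first by rewrite invr_ge0.
    apply: ler_wpM2r; first exact: ltW.
    by apply: ler_wpM2l => //; rewrite ler_pdivlMr// score_var_le.
  by rewrite invfM; ring.
(* Removing a null event leaves the probability of [A] unchanged. *)
- have mAN : measurable (A `&` theta @^-1` N) by exact: measurableI.
  rewrite (le_trans PA)// (measureDI P mA mtN)//.
  rewrite [X in (_ + X)%E](_ : _ = 0%E) ?adde0//.
  apply/eqP; rewrite eq_le measure_ge0 andbT -[leRHS]N0.
  by apply: le_measure; rewrite ?inE.
Qed.
End score_statistic_bound.

Theorem theorem3p2 (R : realType) (D : set R) (C : nat -> R)
    (hD : D `<=` [set delta | 0 < delta < 1])
    (hC : forall d : nat, (1 <= d)%N -> ayvazyan_ulyanov_constant D d (C d))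
    (r n : nat) (hr : (2 <= r)%N) (hn : (1 <= n)%N)
    (J : 'I_r -> R) (hJ : 0 < score_var J)
    (dT : measure_display) (T : measurableType dT) (P : probability T R)
    (p : 'I_n -> {RV P >-> 'S_r}) (theta : {RV P >-> n.-tuple R})
    (p_iid : iid P p) (p_unif : forall i, uniform_permutation (p i))
    (theta_unif : uniform_on_sphere theta)
    (theta_indep : independent_of_family P theta p)
    (B : R) (hB : forall k, `|J k - score_mean J| <= B)
    (k : R.-pker n.-tuple R ~> R)
    (hk : conditional_distribution
      (fun w => score_statistic J (theta w) (fun i => p i w)) theta k)
    (dE : measure_display) (E : measurableType dE) (Q : probability E R)
    (Z : {RV Q >-> R}) (hZ : chi_squared r.-1 Z)
    (delta : R) (hdelta : D delta) :
  with_probability_ge P (1 - delta)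
    [set w | (ereal_sup
        (range (fun t : R =>
          `|k (theta w) [set x : R | (t < x)%R] - Q [set v | (t < Z v)%R]|))
      <= (C r.-1 * r%:R ^+ 2 * B ^+ 2 * ln (1 / delta) ^+ 2
          / (score_var J * n%:R))%:E)%E].
Proof.
(* Writing [r] as [m + 2] and [n] as a successor makes [r - 1] and the sphere match the forms used
   above. *)
destruct r as [|[|m]] => //; destruct n as [|n] => //.
exact: (score_statistic_bound hJ p_iid p_unif theta_unif theta_indep hD
  (hC _ _) hB hk hZ hdelta).
Qed.
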